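(* (a) Let $f:X\to Y$ be a continuous map between compact zero-dimensional Hausdorff spaces, let $A=CO(X)$, $B=CO(Y)$ and let $\varphi=S^t(f):B\to A$ be its Stone dual, $\varphi(G)=f^{-1}(G)$. Then the map $f$ is open iff $\varphi:B\to A$ has a lower adjoint $\psi:A\to B$. (b) The category $\mathbf{OZHC}$ of compact zero-dimensional Hausdorff spaces and (continuous) open maps is dually equivalent to the category $\mathbf{OBool}$ of Boolean algebras and Boolean homomorphisms having lower adjoints.
   Context: A space is zero-dimensional if its clopen subsets form a base. $CO(X)$ is the Boolean algebra of clopen subsets of $X$. A lower adjoint of an order-preserving map $\varphi:P\to Q$ between posets is an order-preserving map $\psi:Q\to P$ such that for all $p\in P$, $q\in Q$: $q\le\varphi(p)$ iff $\psi(q)\le p$. Two categories are dually equivalent if one is equivalent to the opposite of the other. *)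

(* Defs.v *)
From HB Require Import structures.
From mathcomp Require Import all_boot all_order.
From mathcomp Require Import all_classical.
From mathcomp Require Import topology.

Set Implicit Arguments.
Unset Strict Implicit.
Unset Printing Implicit Defensive.

Import Order.TTheory.

Local Open Scope classical_set_scope.

Record category := Category {
  cat_obj :> Type;
  cat_hom : cat_obj -> cat_obj -> Type;
  cat_id : forall a, cat_hom a a;
  cat_comp : forall a b c, cat_hom b c -> cat_hom a b -> cat_hom a c;
  cat_idl : forall a b (f : cat_hom a b), cat_comp (cat_id b) f = f;
  cat_idr : forall a b (f : cat_hom a b), cat_comp f (cat_id a) = f;
  cat_compA : forall a b c d
    (h : cat_hom c d) (g : cat_hom b c) (f : cat_hom a b),
    cat_comp h (cat_comp g f) = cat_comp (cat_comp h g) f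
}.

Definition opposite (C : category) : category :=
  @Category C (fun a b => cat_hom b a) (@cat_id C)
    (fun a b c g f => cat_comp f g)
    (fun a b f => cat_idr f) (fun a b f => cat_idl f)
    (fun a b c d h g f => esym (cat_compA f g h)).

Record functor (C D : category) := Functor {
  fun_obj :> C -> D;
  fun_hom : forall a b, cat_hom a b -> cat_hom (fun_obj a) (fun_obj b);
  fun_id : forall a, fun_hom (cat_id a) = cat_id (fun_obj a);
  fun_comp : forall a b c (g : cat_hom b c) (f : cat_hom a b),
    fun_hom (cat_comp g f) = cat_comp (fun_hom g) (fun_hom f)
}.

Definition functor_id (C : category) : functor C C :=
  @Functor C C id (fun a b f => f) (fun=> erefl) (fun _ _ _ _ _ => erefl).

Section FunctorComp.
Variables (C D E : category) (G : functor D E) (F : functor C D).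

Let gf_hom a b (f : cat_hom a b) := fun_hom G (fun_hom F f).

Fact functor_comp_id a : gf_hom (cat_id a) = cat_id (G (F a)).
Proof. by rewrite /gf_hom !fun_id. Qed.

Fact functor_comp_comp a b c (g : cat_hom b c) (f : cat_hom a b) :
  gf_hom (cat_comp g f) = cat_comp (gf_hom g) (gf_hom f).
Proof. by rewrite /gf_hom !fun_comp. Qed.

Definition functor_comp : functor C E :=
  @Functor C E (fun a => G (F a)) gf_hom functor_comp_id functor_comp_comp.
End FunctorComp.

Definition is_iso (C : category) (a b : C) (f : cat_hom a b) : Prop :=
  exists g : cat_hom b a, cat_comp g f = cat_id a /\ cat_comp f g = cat_id b.

Definition naturally_isomorphic (C D : category) (F G : functor C D) : Prop :=
  exists eta : forall a, cat_hom (F a) (G a),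
    (forall a b (f : cat_hom a b),
       cat_comp (eta b) (fun_hom F f) = cat_comp (fun_hom G f) (eta a)) /\
    (forall a, is_iso (eta a)).

Definition equivalent (C D : category) : Prop :=
  exists (F : functor C D) (G : functor D C),
    naturally_isomorphic (functor_comp G F) (functor_id C) /\
    naturally_isomorphic (functor_comp F G) (functor_id D).

Definition dually_equivalent (C D : category) : Prop :=
  equivalent C (opposite D).

Definition lower_adjoint d d' (P : porderType d) (Q : porderType d')
    (phi : P -> Q) (psi : Q -> P) : Prop :=
  [/\ {homo phi : x y / (x <= y)%O}, {homo psi : x y / (x <= y)%O} &
      forall p q, (q <= phi p)%O = (psi q <= p)%O].

Definition has_lower_adjoint d d' (P : porderType d) (Q : porderType d')
    (phi : P -> Q) : Prop :=
  exists psi : Q -> P, lower_adjoint phi psi.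

Lemma lower_adjoint_id d (P : porderType d) :
  lower_adjoint (@idfun P) (@idfun P).
Proof. by split. Qed.

Lemma lower_adjoint_comp d1 d2 d3 (P : porderType d1) (Q : porderType d2)
    (R : porderType d3) (phi : P -> Q) (psi : Q -> P)
    (phi' : Q -> R) (psi' : R -> Q) :
  lower_adjoint phi psi -> lower_adjoint phi' psi' ->
  lower_adjoint (phi' \o phi) (psi \o psi').
Proof.
move=> [hphi hpsi adj] [hphi' hpsi' adj']; split.
- by move=> x y /hphi /hphi'.
- by move=> x y /hpsi' /hpsi.
- by move=> p q /=; rewrite adj' adj.
Qed.

Definition boolean_hom d d' (A : ctbDistrLatticeType d)
    (B : ctbDistrLatticeType d') (f : A -> B) : Prop :=
  [/\ f \bot%O = \bot%O /\ f \top%O = \top%O,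
      {morph f : x y / (x `&` y)%O},
      {morph f : x y / (x `|` y)%O} &
      {morph f : x / (~` x)%O}].

Lemma boolean_hom_id d (A : ctbDistrLatticeType d) : boolean_hom (@idfun A).
Proof. by split. Qed.

Lemma boolean_hom_comp d1 d2 d3 (A : ctbDistrLatticeType d1)
    (B : ctbDistrLatticeType d2) (C : ctbDistrLatticeType d3)
    (g : B -> C) (f : A -> B) :
  boolean_hom g -> boolean_hom f -> boolean_hom (g \o f).
Proof.
move=> [[g0 g1] gI gU gC] [[f0 f1] fI fU fC]; split.
- by rewrite /= f0 f1.
- by move=> x y /=; rewrite fI gI.
- by move=> x y /=; rewrite fU gU.
- by move=> x /=; rewrite fC gC.
Qed.

Definition clopens (X : topologicalType) : set (set X) := [set A | clopen A].
Arguments clopens X : clear implicits.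

Definition CO (X : topologicalType) : Type := set_type (clopens X).

Section CO.
Variable X : topologicalType.

HB.instance Definition _ := SubChoice.copy (CO X) (set_type (clopens X)).

Fact CO_meet_closed : {in clopens X &, forall A B, (A `&` B)%O \in clopens X}.
Proof.
by move=> A B /set_mem cA /set_mem cB; apply/mem_set; exact: clopenI.
Qed.

Fact CO_join_closed : {in clopens X &, forall A B, (A `|` B)%O \in clopens X}.
Proof.
by move=> A B /set_mem cA /set_mem cB; apply/mem_set; exact: clopenU.
Qed.

Fact CO_bot_closed : \bot%O \in clopens X.
Proof. by apply/mem_set; exact: clopen0. Qed.

Fact CO_top_closed : \top%O \in clopens X.
Proof. by apply/mem_set; exact: clopenT. Qed.

HB.instance Definition _ :=
  Order.SubChoice_isTBSubLattice.Build _ _ _ set_display (CO X)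
    CO_meet_closed CO_join_closed CO_bot_closed CO_top_closed.

Lemma CO_valI (A B : CO X) : val (A `&` B)%O = val A `&` val B.
Proof. by []. Qed.

Lemma CO_valU (A B : CO X) : val (A `|` B)%O = val A `|` val B.
Proof. by []. Qed.

Lemma CO_val0 : val (\bot%O : CO X) = set0.
Proof. by []. Qed.

Lemma CO_val1 : val (\top%O : CO X) = setT.
Proof. by []. Qed.

Lemma CO_leP (A B : CO X) : reflect (val A `<=` val B) (A <= B)%O.
Proof. by rewrite -Order.le_val; exact: subsetPset. Qed.

Fact CO_meetUl : @left_distributive (CO X) (CO X) Order.meet Order.join.
Proof.
by move=> A B C; apply/val_inj; rewrite !(CO_valI, CO_valU) setIUl.
Qed.

HB.instance Definition _ :=
  Order.Lattice_Meet_isDistrLattice.Build set_display (CO X) CO_meetUl.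

Definition CO_compl (A : CO X) : CO X :=
  exist _ (~` val A) (mem_set (clopenC set0 (set_mem (valP A)))).

Fact CO_joinxC (A : CO X) : (A `|` CO_compl A)%O = \top%O.
Proof.
by apply/val_inj; rewrite CO_valU CO_val1; exact: setUv.
Qed.

Fact CO_meetxC (A : CO X) : (A `&` CO_compl A)%O = \bot%O.
Proof.
by apply/val_inj; rewrite CO_valI CO_val0; exact: setICr.
Qed.

HB.instance Definition _ :=
  Order.TBDistrLattice_hasComplement.Build set_display (CO X)
    CO_joinxC CO_meetxC.

End CO.

Definition stone_dual (X Y : topologicalType) (f : X -> Y)
    (cf : continuous f) (G : CO Y) : CO X :=
  exist _ (f @^-1` val G) (mem_set (preimage_clopen (set_mem (valP G)) cf)).

(* The library's [zero_dimensional] only asks that distinct points be separated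
   by clopen sets, hence the explicit base condition. *)
Record zhcSpace := ZHCSpace {
  zhc_sort :> topologicalType;
  zhc_compact : compact [set: zhc_sort];
  zhc_zero_dim : basis (clopens zhc_sort);
  zhc_hausdorff : hausdorff_space zhc_sort
}.

Definition open_map (X Y : topologicalType) (f : X -> Y) : Prop :=
  forall U : set X, open U -> open (f @` U).

Definition ozhc_hom (X Y : zhcSpace) : Type :=
  {f : X -> Y | continuous f /\ open_map f}.

Fact ozhc_id_subproof (X : zhcSpace) :
  continuous (@idfun X) /\ open_map (@idfun X).
Proof. by split=> [|U oU]; [by move=> x | rewrite image_id]. Qed.

Definition ozhc_id (X : zhcSpace) : ozhc_hom X X :=
  exist _ idfun (ozhc_id_subproof X).

Fact ozhc_comp_subproof (X Y Z : zhcSpace)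
    (g : ozhc_hom Y Z) (f : ozhc_hom X Y) :
  continuous (sval g \o sval f) /\ open_map (sval g \o sval f).
Proof.
case: g f => [g [cg og]] [f [cf of_]]; split=> /= [x|U oU].
  by apply: continuous_comp; [exact: cf | exact: cg].
by rewrite -image_comp; apply: og; exact: of_.
Qed.

Definition ozhc_comp (X Y Z : zhcSpace)
    (g : ozhc_hom Y Z) (f : ozhc_hom X Y) : ozhc_hom X Z :=
  exist _ (sval g \o sval f) (ozhc_comp_subproof g f).

Fact ozhc_idl (A B : zhcSpace) (f : ozhc_hom A B) : ozhc_comp (ozhc_id B) f = f.
Proof. by case: f => f pf; exact: eq_exist. Qed.

Fact ozhc_idr (A B : zhcSpace) (f : ozhc_hom A B) : ozhc_comp f (ozhc_id A) = f.
Proof. by case: f => f pf; exact: eq_exist. Qed.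

Fact ozhc_compA (A B C D : zhcSpace) (h : ozhc_hom C D) (g : ozhc_hom B C)
    (f : ozhc_hom A B) :
  ozhc_comp h (ozhc_comp g f) = ozhc_comp (ozhc_comp h g) f.
Proof. exact: eq_exist. Qed.

Definition OZHC : category := Category ozhc_idl ozhc_idr ozhc_compA.

(* [0 = 1] is allowed: the dual of the empty space is the trivial algebra. *)
Record boolAlgebra := BoolAlgebra {
  ba_display : Order.disp_t;
  ba_sort :> ctbDistrLatticeType ba_display
}.

Definition obool_hom (A B : boolAlgebra) : Type :=
  {f : A -> B | boolean_hom f /\ has_lower_adjoint f}.

Definition obool_id (A : boolAlgebra) : obool_hom A A :=
  exist _ idfun (conj (boolean_hom_id A)
    (ex_intro _ idfun (lower_adjoint_id A))).

Fact obool_comp_subproof (A B C : boolAlgebra)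
    (g : obool_hom B C) (f : obool_hom A B) :
  boolean_hom (sval g \o sval f) /\ has_lower_adjoint (sval g \o sval f).
Proof.
case: g f => [g [hg [g' ag]]] [f [hf [f' af]]]; split=> /=.
  exact: boolean_hom_comp.
by exists (f' \o g'); exact: lower_adjoint_comp.
Qed.

Definition obool_comp (A B C : boolAlgebra)
    (g : obool_hom B C) (f : obool_hom A B) : obool_hom A C :=
  exist _ (sval g \o sval f) (obool_comp_subproof g f).

Fact obool_idl (A B : boolAlgebra) (f : obool_hom A B) : obool_comp (obool_id B) f = f.
Proof. by case: f => f pf; exact: eq_exist. Qed.

Fact obool_idr (A B : boolAlgebra) (f : obool_hom A B) : obool_comp f (obool_id A) = f.
Proof. by case: f => f pf; exact: eq_exist. Qed.

Fact obool_compA (A B C D : boolAlgebra) (h : obool_hom C D) (g : obool_hom B C)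
    (f : obool_hom A B) :
  obool_comp h (obool_comp g f) = obool_comp (obool_comp h g) f.
Proof. exact: eq_exist. Qed.

Definition OBool : category := Category obool_idl obool_idr obool_compA.

(* Main.v *)
Require Import Defs.
From HB Require Import structures.
From mathcomp Require Import all_boot all_order.
From mathcomp Require Import all_classical.
From mathcomp Require Import topology.

Set Implicit Arguments.
Unset Strict Implicit.
Unset Printing Implicit Defensive.

Import Order.Theory.
Local Open Scope classical_set_scope.

(** Part (a) is the observation that the lower adjoint of [G |-> f^-1(G)] can
    only be the direct image.  If [f] is open, the image of a clopen set is
    open by assumption and closed by compactness, so direct image is a map
    between the clopen algebras, and it is the lower adjoint.  Conversely let
    [psi] be a lower adjoint and [G] clopen.  Then [f(G)] is contained in
    [psi G] by the unit of the adjunction.  If some point of [psi G] were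
    missing from the closed set [f(G)], a clopen neighbourhood [H] of it would
    miss [f(G)]; then [G] lies in [f^-1(~H)], hence [psi G] in [~H], which is
    absurd.  So [f(G) = psi G] is open, and clopen sets form a base
    ([open_mapP]).

    Part (b) is Stone duality, restricted to the morphisms singled out by (a).
    The points of the Stone space of an algebra [A] are the Boolean
    homomorphisms [x : A -> bool], that is, the ultrafilters of [A]; the sets
    [[a] = {x | x a}] are a base of its topology.  Three facts carry the
    duality: a nonzero element belongs to some ultrafilter
    ([exists_stone_point], by Zorn), the Stone space is compact
    ([stone_space_compact]), and consequently [a |-> [a]] is an isomorphism
    from [A] onto the clopen algebra of the Stone space ([stone_CO_bij]).

    Openness is never checked on points.  Boolean isomorphisms have lower
    adjoints, and adjoints compose; the Stone dual of [x |-> x \o phi] is [phi]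
    conjugated by the isomorphisms [a |-> [a]], and the Stone dual of the
    evaluation [X -> Stone(CO X)] is the inverse of such an isomorphism.
    So (a) shows that the former map is open whenever [phi] has a lower adjoint
    ([stone_map_open]), and that the latter always is ([stone_eval_open]). *)

(** * Compact zero-dimensional spaces and openness of maps *)

Lemma zhc_clopen_nbhs (X : zhcSpace) (x : X) (U : set X) :
  nbhs x U -> exists2 G : CO X, val G x & val G `<=` U.
Proof.
move=> /((zhc_zero_dim X).2 x)[G [cG Gx] GU].
by exists (exist _ G (mem_set cG)).
Qed.

Lemma CO_clopen (X : topologicalType) (G : CO X) : clopen (val G).
Proof. exact: set_mem (valP G). Qed.

Lemma CO_open (X : topologicalType) (G : CO X) : open (val G).
Proof. exact: (CO_clopen G).1. Qed.

Lemma zhc_clopen_closed (X : zhcSpace) (x : X) (C : set X) :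
  closed C -> ~ C x -> exists2 G : CO X, val G x & val G `<=` ~` C.
Proof.
move=> cC nCx; apply: zhc_clopen_nbhs; apply: open_nbhs_nbhs; split => //.
exact: closed_openC.
Qed.

Lemma zhc_separated (X : zhcSpace) (x y : X) :
  (forall G : CO X, val G x -> val G y) -> x = y.
Proof.
move=> xy; apply: contrapT => nxy.
have cy : closed [set y].
  exact: accessible_closed_set1 (hausdorff_accessible (@zhc_hausdorff X)) y.
have [G Gx Gy] := zhc_clopen_closed cy nxy.
by apply: (Gy y) => //; exact: xy.
Qed.

Lemma zhc_closed_image (X Y : zhcSpace) (f : X -> Y) (G : CO X) :
  continuous f -> closed (f @` val G).
Proof.
move=> cf; apply: compact_closed; first exact: zhc_hausdorff.
apply: continuous_compact; first exact: continuous_subspaceT.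
exact: subclosed_compact (CO_clopen G).2 (@zhc_compact X) _.
Qed.

(** Images commute with unions and clopen sets form a base, so clopen sets test
    openness. *)
Lemma open_map_CO (X Y : zhcSpace) (f : X -> Y) :
  (forall G : CO X, open (f @` val G)) -> open_map f.
Proof.
move=> of_ U oU; rewrite openE => _ [x Ux <-].
have [G Gx GU] := zhc_clopen_nbhs (open_nbhs_nbhs (conj oU Ux)).
apply: (@filterS _ _ _ (f @` val G)); first exact: image_subset.
by apply: open_nbhs_nbhs; split; [exact: of_ | exists x].
Qed.

(** Direct image is the only possible lower adjoint of inverse image, and it
    maps clopen sets to clopen sets exactly when [f] is open. *)
Lemma open_mapP (X Y : zhcSpace) (f : X -> Y) (cf : continuous f) :
  open_map f <-> has_lower_adjoint (stone_dual cf : CO Y -> CO X).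
Proof.
split=> [of_|[psi [_ _ adj]]].
  have cofG (G : CO X) : clopen (f @` val G).
    by split; [apply: of_; exact: CO_open | exact: zhc_closed_image].
  exists (fun G => exist _ (f @` val G) (mem_set (cofG G))); split.
  - by move=> G H /CO_leP GH; apply/CO_leP; exact: preimage_subset.
  - by move=> G H /CO_leP GH; apply/CO_leP; exact: image_subset.
  - move=> H G; apply/CO_leP/CO_leP => /= GH.
      by move=> _ [x /GH Hx <-].
    by move=> x Gx; apply: GH; exists x.
apply: open_map_CO => G.
suff -> : f @` val G = val (psi G) by exact: CO_open.
apply/seteqP; split.
  have /CO_leP GpsiG : (G <= (stone_dual cf (psi G) : CO X))%O by rewrite adj.
  by move=> _ [x /GpsiG ? <-].
move=> y psiGy; apply: contrapT => nfGy.
have [H Hy HG] := zhc_clopen_closed (zhc_closed_image (G := G) cf) nfGy.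
have /CO_leP/(_ y psiGy) : (psi G <= (~` H : CO Y))%O; last by apply.
rewrite -adj; apply/CO_leP => x Gx /= Hfx.
by apply: (HG _ Hfx); exists x.
Qed.

(** * Boolean homomorphisms and isomorphisms *)

(** The constants are recovered as [a /\ ~a] and its complement, the joins by
    De Morgan. *)
Lemma boolean_hom_meet_compl d d' (A : ctbDistrLatticeType d)
    (B : ctbDistrLatticeType d') (f : A -> B) :
  {morph f : a b / (a `&` b)%O} -> {morph f : a / (~` a)%O} -> boolean_hom f.
Proof.
move=> fI fC.
have f0 : f \bot%O = \bot%O by rewrite -(meetxC \bot%O) fI fC meetxC.
split => // [|a b].
  by rewrite -compl0 fC f0 compl0.
by rewrite -[(a `|` b)%O]complK complU fC fI !fC complI !complK.
Qed.

Lemma boolean_hom_homo d d' (A : ctbDistrLatticeType d)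
    (B : ctbDistrLatticeType d') (f : A -> B) :
  boolean_hom f -> {homo f : a b / (a <= b)%O}.
Proof. by move=> [_ fI _ _] a b /meet_idPl ab; rewrite -ab fI leIr. Qed.

Lemma boolean_hom_can d d' (A : ctbDistrLatticeType d)
    (B : ctbDistrLatticeType d') (f : A -> B) (g : B -> A) :
  boolean_hom f -> cancel f g -> cancel g f -> boolean_hom g.
Proof.
move=> [_ fI _ fC] fK gK; apply: boolean_hom_meet_compl => [a b|a];
  apply: (can_inj fK); first by rewrite fI !gK.
by rewrite fC !gK.
Qed.

Lemma boolean_iso_adjoint d d' (A : ctbDistrLatticeType d)
    (B : ctbDistrLatticeType d') (f : A -> B) (g : B -> A) :
  boolean_hom f -> cancel f g -> cancel g f -> lower_adjoint f g.
Proof.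
move=> hf fK gK; have hg := boolean_hom_can hf fK gK.
split; [exact: boolean_hom_homo | exact: boolean_hom_homo | move=> a b].
by apply/idP/idP => [/(boolean_hom_homo hg)|/(boolean_hom_homo hf)];
  rewrite ?fK ?gK.
Qed.

(** * The Stone space of a Boolean algebra *)

Section StoneSpace.
Context {d : Order.disp_t} (A : ctbDistrLatticeType d).

(** An ultrafilter of [A] is encoded by its characteristic function, so that
    functoriality is mere composition of homomorphisms. *)
Record stone_space := StonePoint {
  stone_fun :> A -> bool;
  stone_funP : boolean_hom stone_fun
}.

HB.instance Definition _ := gen_eqMixin stone_space.
HB.instance Definition _ := gen_choiceMixin stone_space.

Implicit Types (x y : stone_space) (a b : A).

Lemma stone_point_ext x y : (forall a, x a = y a) -> x = y.
Proof.
case: x y => x hx [y hy] /= /funext xy; rewrite xy in hx *.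
by rewrite (Prop_irrelevance hx hy).
Qed.

Definition stone_basic a : set stone_space := [set x : stone_space | x a].

Lemma stone_basic0 : stone_basic \bot%O = set0.
Proof.
apply/seteqP; split=> x //=; rewrite /stone_basic /=.
by have [[-> _] _ _ _] := stone_funP x.
Qed.

Lemma stone_basicT : stone_basic \top%O = setT.
Proof.
apply/seteqP; split=> x //= _; rewrite /stone_basic /=.
by have [[_ ->] _ _ _] := stone_funP x.
Qed.

Lemma stone_basicI a b :
  stone_basic (a `&` b)%O = stone_basic a `&` stone_basic b.
Proof.
apply/seteqP; split=> x; rewrite /stone_basic /=;
  have [_ -> _ _] := stone_funP x; first by move/andP.
by move=> ?; apply/andP.
Qed.

Lemma stone_basicU a b :
  stone_basic (a `|` b)%O = stone_basic a `|` stone_basic b.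
Proof.
apply/seteqP; split=> x; rewrite /stone_basic /=;
  have [_ _ -> _] := stone_funP x; first by move/orP.
by move=> ?; apply/orP.
Qed.

Lemma stone_basicC a : stone_basic (~` a)%O = ~` stone_basic a.
Proof.
apply/seteqP; split=> x; rewrite /stone_basic /=;
  have [_ _ _ ->] := stone_funP x; first by move/negP.
by move=> ?; apply/negP.
Qed.

(** The topology generated by the sets [stone_basic a]; they are closed under
    binary intersections, hence a base. *)
Definition stone_open (U : set stone_space) : Prop :=
  forall x, U x -> exists2 a, stone_basic a x & stone_basic a `<=` U.

Fact stone_openT : stone_open setT.
Proof. by move=> x _; exists \top%O => //; rewrite stone_basicT. Qed.

Fact stone_openI : setI_closed stone_open.
Proof.
move=> U V oU oV x [/oU[a ax aU] /oV[b bx bV]].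
by exists (a `&` b)%O; rewrite stone_basicI //; exact: setISS.
Qed.

Fact stone_open_bigU (I : Type) (f : I -> set stone_space) :
  (forall i, stone_open (f i)) -> stone_open (\bigcup_i f i).
Proof.
move=> of_ x [i _ /of_[a ax af]]; exists a => //.
by apply: subset_trans af _; exact: bigcup_sup.
Qed.

HB.instance Definition _ := isOpenTopological.Build stone_space
  stone_openT stone_openI stone_open_bigU.

Lemma stone_openE (U : set stone_space) : open U = stone_open U.
Proof. by []. Qed.

Lemma stone_basic_clopen a : clopen (stone_basic a).
Proof.
have ob b : open (stone_basic b) by move=> x bx; exists b.
by split; [exact: ob | rewrite -openC -stone_basicC; exact: ob].
Qed.

Lemma stone_space_basis : basis (clopens stone_space).
Proof.
split=> [U []//|x U]; rewrite nbhsE => -[V [oV Vx] VU].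
have [a ax aV] := oV x Vx.
exists (stone_basic a); last exact: subset_trans aV VU.
by split => //; exact: stone_basic_clopen.
Qed.

(** An element on which two points disagree, and its complement, give disjoint
    neighbourhoods. *)
Lemma stone_space_hausdorff : hausdorff_space stone_space.
Proof.
move=> x y xy.
have imp a : x a -> y a.
  move=> xa; apply: contrapT => nya.
  have nbx : nbhs x (stone_basic a).
    by apply: open_nbhs_nbhs; split => //; exact: (stone_basic_clopen a).1.
  have nby : nbhs y (stone_basic (~` a)%O).
    apply: open_nbhs_nbhs; split; first exact: (stone_basic_clopen _).1.
    by rewrite stone_basicC.
  have [z [za]] := xy _ _ nbx nby.
  by rewrite stone_basicC.
apply: stone_point_ext => a; apply/idP/idP; first exact: imp.
have [_ _ _ xC] := stone_funP x; have [_ _ _ yC] := stone_funP y.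
apply: contraTT; have := imp (~` a)%O.
by rewrite xC yC.
Qed.

(** The limit of an ultrafilter [F] on the Stone space: [a] belongs to the
    limit point when [F] contains the basic set of [a]. *)
Fact ultra_boolean_hom (F : set_system stone_space) : UltraFilter F ->
  boolean_hom (fun a => `[< F (stone_basic a) >]).
Proof.
move=> FU.
have hI : {morph (fun a => `[< F (stone_basic a) >]) : a b / (a `&` b)%O}.
  move=> a b /=; rewrite stone_basicI; apply/asboolP/idP.
    by move=> Fab; apply/andP; split; apply/asboolP; apply: filterS Fab => x [].
  by move=> /andP[/asboolP Fa /asboolP Fb]; exact: filterI.
have hC : {morph (fun a => `[< F (stone_basic a) >]) : a / (~` a)%O}.
  move=> a /=; rewrite stone_basicC; apply/asboolP/idP.
    move=> FCa; apply/negP => /asboolP Fa.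
    have : F (stone_basic a `&` ~` stone_basic a) by exact: filterI.
    by rewrite setICr; exact: filter_not_empty.
  move=> /negP nFa; have [Fa|//] := in_ultra_setVsetC (stone_basic a) FU.
  by exfalso; apply: nFa; exact/asboolP.
exact: boolean_hom_meet_compl.
Qed.

Lemma stone_space_compact : compact [set: stone_space].
Proof.
rewrite compact_ultra => F FU _.
exists (StonePoint (ultra_boolean_hom FU)); split=> // U.
rewrite nbhsE => -[V [oV Vx] VU].
have [a /asboolP Fa aV] := oV _ Vx.
by apply: filterS Fa; exact: subset_trans aV VU.
Qed.

(** The Boolean prime ideal theorem.  Zorn is applied to the sets [S] closed
    under meets and upwards, with no member disjoint from [c].  The empty set is
    allowed, which makes the union of the empty chain harmless; a maximal [M]
    nevertheless contains [c].  If neither [a] nor [~a] were in [M], adjoining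
    either one would yield a member disjoint from [c], hence members [m] and
    [n] of [M] with [m /\ n /\ c <= (m /\ a /\ c) \/ (n /\ ~a /\ c) = 0],
    which is impossible. *)
Lemma exists_stone_point c : c != \bot%O -> exists x : stone_space, x c.
Proof.
move=> c0.
pose P (S : set A) := [/\ forall a b, S a -> S b -> S (a `&` b)%O,
  forall a b, (a <= b)%O -> S a -> S b & forall a, S a -> (a `&` c != \bot)%O].
have [F FP totF|M [[MI MU Mc] Mmax]] := @Zorn_bigcup A P.
  split=> [a b [S FS Sa] [T FT Tb]|a b ab [S FS Sa]|a [S FS Sa]].
  - have [ST|TS] := totF _ _ FS FT.
      by exists T => //; have [+ _ _] := FP _ FT; apply => //; exact: ST.
    by exists S => //; have [+ _ _] := FP _ FS; apply => //; exact: TS.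
  - by exists S => //; have [_ + _] := FP _ FS; apply; first exact: ab.
  - by have [_ _ +] := FP _ FS; apply.
(* The filter generated by M and a; top is added in case M is empty, which is
   not excluded yet. *)
pose gen a := [set b | exists2 m, m = \top%O \/ M m & (m `&` a <= b)%O].
have mI m n : m = \top%O \/ M m -> n = \top%O \/ M n ->
    (m `&` n)%O = \top%O \/ M (m `&` n)%O.
  move=> [->|Mm] [->|Mn]; rewrite ?(meetxx, meet1x, meetx1); [left|right..] => //.
  exact: MI.
have mc m : m = \top%O \/ M m -> (m `&` c != \bot)%O.
  by move=> [->|/Mc//]; rewrite meet1x.
have genM a : ~ M a -> exists2 m, m = \top%O \/ M m & (m `&` a `&` c = \bot)%O.
  move=> nMa; apply: contrapT => hm; apply: (Mmax (gen a)); last first.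
    split=> [b b' [m Mm mb] [n Mn nb]|b b' bb' [m Mm mb]|b [m Mm mb]].
    - exists (m `&` n)%O; first exact: mI.
      rewrite lexI (le_trans _ mb) ?(le_trans _ nb) //.
        by rewrite leI2 // leIr.
      by rewrite leI2 // leIl.
    - by exists m => //; exact: le_trans bb'.
    - apply/eqP => bc0; apply: hm; exists m => //.
      by apply/eqP; rewrite -lex0 -bc0 leI2.
  split=> [m Mm|genM]; first by exists m; [right | rewrite leIl].
  by apply/nMa/genM; exists \top%O; [left | rewrite meet1x].
have M_c : M c.
  apply: contrapT => /genM[m hm mcc]; have := mc m hm.
  by rewrite -mcc -meetA meetxx eqxx.
have MC a : M (~` a)%O <-> ~ M a.
  split=> [MCa Ma|nMa].
    by have := Mc _ (MI _ _ Ma MCa); rewrite meetxC meet0x eqxx.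
  apply: contrapT => nMCa.
  have [m hm mac] := genM _ nMa; have [n hn nac] := genM _ nMCa.
  have /negP := mc _ (mI _ _ hm hn); apply.
  apply/eqP; rewrite -(meetx1 (m `&` n `&` c)%O) -(joinxC a) meetUr.
  have -> : (m `&` n `&` c `&` a = n `&` (m `&` a `&` c))%O.
    by rewrite meetAC (meetC m) !meetA.
  have -> : (m `&` n `&` c `&` ~` a = m `&` (n `&` ~` a `&` c))%O.
    by rewrite !meetA meetAC.
  by rewrite mac nac !meetx0 joinxx.
have xh : boolean_hom (fun a => `[< M a >]).
  apply: boolean_hom_meet_compl => [a b|a] /=.
    apply/asboolP/idP.
      by move=> Mab; apply/andP; split; apply/asboolP; apply: MU Mab;
        rewrite ?leIl ?leIr.
    by move=> /andP[/asboolP Ma /asboolP Mb]; exact: MI.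
  apply/asboolP/idP => [/MC nMa|/negP nMa]; first by apply/negP => /asboolP.
  by apply/MC => Ma; apply: nMa; exact/asboolP.
by exists (StonePoint xh); exact/asboolP.
Qed.

(** If [a <= b] fails, a point of [a /\ ~b] distinguishes the basic sets of [a]
    and [b]. *)
Lemma stone_basic_inj : injective stone_basic.
Proof.
have le a b : stone_basic a `<=` stone_basic b -> (a <= b)%O.
  move=> ab; rewrite -[b]complK -disj_leC; apply/negPn/negP.
  move=> /exists_stone_point[x].
  rewrite -[x _ : Prop]/(stone_basic (a `&` ~` b)%O x) stone_basicI stone_basicC.
  by move=> [/ab].
by move=> a b ab; apply/le_anti; rewrite !le // ab.
Qed.

(** A clopen [U] is a union of basic sets, directed because basic sets are closed
    under binary unions.  If none of them were all of [U], their complements in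
    [U] would generate a proper filter, and a cluster point of it in [U] would
    lie in none of the basic subsets of [U]. *)
Lemma stone_clopen_basic (U : set stone_space) :
  clopen U -> exists a, stone_basic a = U.
Proof.
move=> [oU cU].
have cptU : compact U by exact: subclosed_compact cU stone_space_compact _.
apply: contrapT => nU.
pose F := filter_from [set a | stone_basic a `<=` U]
  (fun a => U `\` stone_basic a).
have FF : ProperFilter F.
  apply: filter_from_proper => [|a aU].
    apply: filter_from_filter; first by exists \bot%O; rewrite /= stone_basic0.
    move=> a b aU bU; exists (a `|` b)%O.
      by rewrite /= stone_basicU subUset; split.
    by rewrite stone_basicU setDUr.
  apply/set0P/negP => /eqP UDa0; apply: nU; exists a; apply/seteqP.
  by split => //; rewrite -setD_eq0.
have FU : F U by exists \bot%O; rewrite /= ?stone_basic0 // setD0.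
have [x [Ux xF]] := cptU F FF FU; have [a ax aU] := oU x Ux.
have Fa : F (U `\` stone_basic a) by exists a.
have nba : nbhs x (stone_basic a).
  by apply: open_nbhs_nbhs; split => //; exact: (stone_basic_clopen a).1.
by have [y [[]]] := xF _ _ Fa nba.
Qed.

Definition stone_CO (a : A) : CO stone_space :=
  exist _ (stone_basic a) (mem_set (stone_basic_clopen a)).

Lemma stone_CO_hom : boolean_hom stone_CO.
Proof.
apply: boolean_hom_meet_compl => [a b|a]; apply/val_inj.
  exact: stone_basicI.
exact: stone_basicC.
Qed.

Lemma stone_CO_bij : exists r, cancel stone_CO r /\ cancel r stone_CO.
Proof.
have /choice[r rK] (U : CO stone_space) : exists a, stone_basic a = val U.
  exact: stone_clopen_basic (CO_clopen U).
exists r; split=> [a|U]; first exact/stone_basic_inj/rK.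
exact/val_inj/rK.
Qed.

End StoneSpace.

Definition stone_zhc d (A : ctbDistrLatticeType d) : zhcSpace :=
  ZHCSpace (@stone_space_compact d A) (@stone_space_basis d A)
    (@stone_space_hausdorff d A).

(** * Functoriality: precomposition with a homomorphism *)

Section StoneMap.
Context d d' (A : ctbDistrLatticeType d) (B : ctbDistrLatticeType d').
Variables (phi : B -> A) (hphi : boolean_hom phi).

Definition stone_map (x : stone_zhc A) : stone_zhc B :=
  StonePoint (boolean_hom_comp (stone_funP x) hphi).

Lemma stone_map_continuous : continuous stone_map.
Proof.
apply/continuousP => V oV; rewrite stone_openE => x Vx.
have [b bx bV] := oV _ Vx.
by exists (phi b) => //= y by_; exact: bV.
Qed.

Lemma stone_dual_map (b : B) :
  stone_dual stone_map_continuous (stone_CO b) = stone_CO (phi b).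
Proof. exact: val_inj. Qed.

(** The dual of [stone_map] is [phi] conjugated by Boolean isomorphisms, so it
    inherits a lower adjoint. *)
Lemma stone_map_open : has_lower_adjoint phi -> open_map stone_map.
Proof.
move=> [psi adj]; apply/(open_mapP stone_map_continuous).
have [r [rK Kr]] := stone_CO_bij A; have [s [sK Ks]] := stone_CO_bij B.
have -> : stone_dual stone_map_continuous = @stone_CO _ A \o phi \o s.
  by apply/funext => U; rewrite -{1}[U]Ks stone_dual_map.
exists (@stone_CO _ B \o (psi \o r)); apply: lower_adjoint_comp.
  apply: boolean_iso_adjoint => //; apply: boolean_hom_can sK Ks.
  exact: stone_CO_hom.
apply: lower_adjoint_comp => //.
by apply: boolean_iso_adjoint => //; exact: stone_CO_hom.
Qed.

End StoneMap.

(** * Every compact zero-dimensional space is a Stone space *)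

Section Evaluation.
Variable X : zhcSpace.

Fact stone_eval_hom (x : X) : boolean_hom (fun U : CO X => `[< val U x >]).
Proof.
apply: boolean_hom_meet_compl => [U V|U]; first exact: asbool_and.
exact: asbool_neg.
Qed.

Definition stone_eval (x : X) : stone_zhc (CO X) := StonePoint (stone_eval_hom x).

Lemma stone_eval_continuous : continuous stone_eval.
Proof.
apply/continuousP => V oV; rewrite openE => x Vx.
have [U /asboolP Ux UV] := oV _ Vx.
apply: (@filterS _ _ _ (val U)).
  by move=> y Uy; apply: UV; exact/asboolP.
by apply: open_nbhs_nbhs; split => //; exact: CO_open.
Qed.

(** Up to the isomorphism [stone_CO], the dual of the evaluation map is the
    identity, which is why that map is open. *)
Lemma stone_dual_eval (U : CO X) :
  stone_dual stone_eval_continuous (stone_CO U) = U.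
Proof.
by apply/val_inj/seteqP; split=> x /asboolP.
Qed.

Lemma stone_eval_open : open_map stone_eval.
Proof.
apply/(open_mapP stone_eval_continuous).
have [r [rK Kr]] := stone_CO_bij (CO X).
have -> : stone_dual stone_eval_continuous = r.
  by apply/funext => U; rewrite -[U]Kr stone_dual_eval rK.
exists (@stone_CO _ (CO X)); apply: boolean_iso_adjoint => //.
exact: boolean_hom_can (stone_CO_hom (CO X)) rK Kr.
Qed.

Lemma stone_eval_inj : injective stone_eval.
Proof.
move=> x y xy; apply: zhc_separated => G Gx.
have : stone_eval y G by rewrite -xy; exact/asboolP.
by move/asboolP.
Qed.

(** The range is closed by compactness, and it is dense: a point of the clopen
    set [U] evaluates to a point of the basic set of [U]. *)
Lemma stone_eval_surj u : exists x, stone_eval x = u.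
Proof.
have cl : closed (range stone_eval).
  by have := zhc_closed_image (G := \top%O) stone_eval_continuous.
apply: contrapT => nu.
have nuR : ~ range stone_eval u by move=> [x _ xu]; apply: nu; exists x.
have [W Wu Wr] := zhc_clopen_closed cl nuR.
have [U UW] := stone_clopen_basic (CO_clopen W).
have uU : u U by rewrite -[u U : Prop]/(stone_basic U u) UW.
have [U0|/set0P[x Ux]] := eqVneq (val U) set0.
  have UE : U = \bot%O by exact: val_inj.
  by have : stone_basic U u by []; rewrite UE stone_basic0.
apply: (Wr (stone_eval x)); last by exists x.
by rewrite -UW; exact/asboolP.
Qed.

End Evaluation.

(** * Isomorphisms in the categories *)

Lemma natural_iso_sym (C D : category) (F G : functor C D) :
  naturally_isomorphic F G -> naturally_isomorphic G F.
Proof.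
move=> [eta [nat iso]].
pose inv a := sval (cid (iso a)).
have invl a : cat_comp (inv a) (eta a) = cat_id (F a).
  by rewrite /inv; case: cid => g [].
have invr a : cat_comp (eta a) (inv a) = cat_id (G a).
  by rewrite /inv; case: cid => g [].
exists inv; split=> [a b f|a]; last by exists (eta a).
rewrite -[LHS]cat_idr -(invr a) cat_compA -[in LHS](cat_compA (inv b)) -nat.
by rewrite !cat_compA invl cat_idl.
Qed.

Lemma is_iso_opposite (C : category) (a b : C) (f : cat_hom a b) :
  is_iso f -> @is_iso (opposite C) b a f.
Proof. by move=> [g [gf fg]]; exists g. Qed.

(** Openness of [f] is continuity of its inverse, and continuity of [f] is
    openness of its inverse. *)
Lemma ozhc_iso (X Y : zhcSpace) (f : ozhc_hom X Y) (g : Y -> X) :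
  cancel (sval f) g -> cancel g (sval f) -> @is_iso OZHC X Y f.
Proof.
case: f => f [cf of_] /= fK gK.
have gV U : g @^-1` U = f @` U.
  apply/seteqP; split=> [y Uy|_ [x Ux <-]]; first by exists (g y).
  by rewrite /= fK.
have gI V : g @` V = f @^-1` V.
  apply/seteqP; split=> [_ [y Vy <-]|x Vx]; first by rewrite /= gK.
  by exists (f x).
have cg : continuous g /\ open_map g.
  split=> [|V oV]; last by rewrite gI; move/continuousP: cf; apply.
  by apply/continuousP => U oU; rewrite gV; exact: of_.
exists (exist _ g cg); split; apply: eq_exist; apply/funext.
- exact: fK.
- exact: gK.
Qed.

(** The inverse of a Boolean isomorphism is a homomorphism, and [f] is its lower
    adjoint. *)
Lemma obool_iso (A B : boolAlgebra) (f : obool_hom A B) (g : B -> A) :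
  cancel (sval f) g -> cancel g (sval f) -> @is_iso OBool A B f.
Proof.
case: f => f [hf af] /= fK gK.
have hg := boolean_hom_can hf fK gK.
have ag : has_lower_adjoint g by exists f; exact: boolean_iso_adjoint.
exists (exist _ g (conj hg ag)); split; apply: eq_exist; apply/funext.
- exact: fK.
- exact: gK.
Qed.

(** * The two functors and the duality *)

Definition CO_obj (X : zhcSpace) : boolAlgebra := BoolAlgebra (CO X).

Lemma stone_dual_hom (X Y : topologicalType) (f : X -> Y) (cf : continuous f) :
  boolean_hom (stone_dual cf : CO Y -> CO X).
Proof. by apply: boolean_hom_meet_compl => [G H|G]; exact: val_inj. Qed.

Definition CO_hom (X Y : zhcSpace) (f : ozhc_hom X Y) :
    obool_hom (CO_obj Y) (CO_obj X) :=
  exist _ (stone_dual (svalP f).1)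
    (conj (stone_dual_hom _) ((open_mapP _).1 (svalP f).2)).

Fact CO_hom_id (X : zhcSpace) : CO_hom (ozhc_id X) = obool_id (CO_obj X).
Proof. by apply: eq_exist; apply/funext => G; exact: val_inj. Qed.

Fact CO_hom_comp (X Y Z : zhcSpace) (g : ozhc_hom Y Z) (f : ozhc_hom X Y) :
  CO_hom (ozhc_comp g f) = obool_comp (CO_hom f) (CO_hom g).
Proof. by apply: eq_exist; apply/funext => G; exact: val_inj. Qed.

Definition CO_functor : functor OZHC (opposite OBool) :=
  @Functor OZHC (opposite OBool) CO_obj CO_hom CO_hom_id CO_hom_comp.

Definition stone_obj (A : boolAlgebra) : zhcSpace := stone_zhc A.

Definition stone_hom (A B : boolAlgebra) (phi : obool_hom B A) :
    ozhc_hom (stone_obj A) (stone_obj B) :=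
  exist _ (stone_map (svalP phi).1)
    (conj (stone_map_continuous (hphi := (svalP phi).1))
          (stone_map_open (svalP phi).2)).

Fact stone_hom_id (A : boolAlgebra) :
  stone_hom (obool_id A) = ozhc_id (stone_obj A).
Proof. by apply: eq_exist; apply/funext => x; exact: stone_point_ext. Qed.

Fact stone_hom_comp (A B C : boolAlgebra)
    (psi : obool_hom C B) (phi : obool_hom B A) :
  stone_hom (obool_comp phi psi) = ozhc_comp (stone_hom psi) (stone_hom phi).
Proof. by apply: eq_exist; apply/funext => x; exact: stone_point_ext. Qed.

Definition stone_functor : functor (opposite OBool) OZHC :=
  @Functor (opposite OBool) OZHC stone_obj stone_hom stone_hom_id
    stone_hom_comp.

Lemma stone_eval_natural :
  naturally_isomorphic (functor_id OZHC) (functor_comp stone_functor CO_functor).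
Proof.
pose ev (X : zhcSpace) : ozhc_hom X (stone_zhc (CO X)) :=
  exist _ (@stone_eval X) (conj (@stone_eval_continuous X) (@stone_eval_open X)).
exists ev; split=> [X Y f|X].
  by apply: eq_exist; apply/funext => x; exact: stone_point_ext.
have /choice[g gK] := @stone_eval_surj X.
apply: (@ozhc_iso _ _ (ev X) g) => //= x.
exact: stone_eval_inj.
Qed.

Lemma stone_CO_natural :
  naturally_isomorphic (functor_comp CO_functor stone_functor)
    (functor_id (opposite OBool)).
Proof.
have adj (A : boolAlgebra) : has_lower_adjoint (@stone_CO _ A).
  have [r [rK Kr]] := stone_CO_bij A.
  by exists r; apply: boolean_iso_adjoint => //; exact: stone_CO_hom.
pose e (A : boolAlgebra) : obool_hom A (CO_obj (stone_obj A)) :=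
  exist _ (@stone_CO _ A) (conj (stone_CO_hom A) (adj A)).
exists e; split=> [A B phi|A].
  by apply: eq_exist; apply/funext => b; exact: val_inj.
apply: is_iso_opposite; have [r [rK Kr]] := stone_CO_bij A.
exact: (@obool_iso _ _ (e A) r).
Qed.

Theorem corollary2p12 :
  (forall (X Y : zhcSpace) (f : X -> Y) (cf : continuous f),
     open_map f <-> has_lower_adjoint (stone_dual cf : CO Y -> CO X)) /\
  dually_equivalent OZHC OBool.
Proof.
split; first exact: open_mapP.
exists CO_functor, stone_functor; split; last exact: stone_CO_natural.
exact/natural_iso_sym/stone_eval_natural.
Qed.
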